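(* Let $R\in\mathbb S^m$ be the matrix adopted in the algorithm described in the context, and let the expert's matrices $R_e,Q_e,Q_{\Gamma_e},P_e,S_e$, with gains $K_e,\bar K_e$, satisfy $$A^{\top}P_e+P_eA+C^{\top}P_eC-(B^{\top}P_e+D^{\top}P_eC)^{\top}\Lambda_e^{-1}(B^{\top}P_e+D^{\top}P_eC)+Q_e=0,$$ $$(A-BK_e)^{\top}S_e+S_e(A-BK_e)-S_eB\Lambda_e^{-1}B^{\top}S_e-Q_{\Gamma_e}=0,$$ $$K_e=\Lambda_e^{-1}(B^{\top}P_e+D^{\top}P_eC),\qquad \bar K_e=\Lambda_e^{-1}B^{\top}S_e,\qquad \Lambda_e=R_e+D^{\top}P_eD.$$ Put $R_o=R-R_e$, and suppose there exist symmetric matrices $Q_o,Q_{\Gamma_o},P_o,S_o\in\mathbb S^n$ satisfying $$B^{\top}P_o+D^{\top}P_oC=(R_o+D^{\top}P_oD)\Lambda_e^{-1}(B^{\top}P_e+D^{\top}P_eC),$$ $$B^{\top}S_o=(R_o+D^{\top}P_oD)\Lambda_e^{-1}B^{\top}S_e,$$ $$A^{\top}P_o+P_oA+C^{\top}P_oC+Q_o-K_e^{\top}(R_o+D^{\top}P_oD)K_e=0,$$ $$(A-BK_e)^{\top}S_o+S_o(A-BK_e)-Q_{\Gamma_o}-\bar K_e^{\top}(R_o+D^{\top}P_oD)\bar K_e=0.$$ Then any converged solutions $Q^*=Q_e+Q_o$, $Q_\Gamma^*=Q_{\Gamma_e}+Q_{\Gamma_o}$, $P^*=P_e+P_o$,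 $S^*=S_e+S_o$ of the algorithm satisfy, with $\Lambda^*=R+D^{\top}P^*D$, $$A^{\top}P^*+P^*A+C^{\top}P^*C-(B^{\top}P^*+D^{\top}P^*C)^{\top}(\Lambda^* )^{-1}(B^{\top}P^*+D^{\top}P^*C)+Q^*=0,$$ $$(A-BK^* )^{\top}S^*+S^*(A-BK^* )-S^*B(\Lambda^* )^{-1}B^{\top}S^*-Q_\Gamma^*=0,$$ and they give the expert gains: $$K^*:=(\Lambda^* )^{-1}(B^{\top}P^*+D^{\top}P^*C)=K_e,\qquad \bar K^*:=(\Lambda^* )^{-1}B^{\top}S^*=\bar K_e.$$
   Context: $\mathbb S^n$ denotes the real symmetric $n\times n$ matrices. $A,C\in\mathbb R^{n\times n}$, $B,D\in\mathbb R^{n\times m}$ are fixed; $Q_e,Q_{\Gamma_e}\in\mathbb S^n$, $R_e\in\mathbb S^m$ may be indefinite. All inverses written (in particular of $\Lambda_e$ and of $\Lambda^*$) are understood to exist; in the paper these matrices are positive definite. The algorithm: fix $R\in\mathbb S^m$ and initial symmetric weights $Q^0,Q_\Gamma^0$. Loop 1: for $l\ge0$, $P^l$ solves $(A-BK_e)^{\top}P^l+P^l(A-BK_e)+(C-DK_e)^{\top}P^l(C-DK_e)=-Q^l-K_e^{\top}RK_e$; with $\Lambda^l=R+D^{\top}P^lD$ put $K^l=(\Lambda^l)^{-1}(B^{\top}P^l+D^{\top}P^lC)$ and $Q^{l+1}=-A^{\top}P^l-P^lA-C^{\top}P^lC+(K^l)^{\top}\Lambda^lK^l$. Its converged values are $P^*,Q^*,K^*$,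 and $\Lambda^*=R+D^{\top}P^*D$. Loop 2: for $k\ge0$, $S^k$ solves $(A-B(K^*+\bar K_e))^{\top}S^k+S^k(A-B(K^*+\bar K_e))=-\bar K_e^{\top}\Lambda^*\bar K_e+Q_\Gamma^k$; put $\bar K^k=(\Lambda^* )^{-1}B^{\top}S^k$ and $Q_\Gamma^{k+1}=(A-BK^* )^{\top}S^k+S^k(A-BK^* )-(\bar K^k)^{\top}\Lambda^*\bar K^k$. Its converged values are $S^*,Q_\Gamma^*,\bar K^*$. *)

(* Defs.v *)
From HB Require Import structures.
From mathcomp Require Import all_boot all_order all_algebra.
From mathcomp Require Import all_classical all_reals all_analysis.

Set Implicit Arguments.
Unset Strict Implicit.
Unset Printing Implicit Defensive.

Import Order.TTheory GRing.Theory Num.Theory.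
Import numFieldNormedType.Exports.

Local Open Scope classical_set_scope.
Local Open Scope ring_scope.

(* [invmx L] is the inverse of [L] only when [L \in unitmx] (it is [L]
   otherwise), so every use of these definitions comes with a [unitmx]
   condition. *)
Section Algorithm.
Variables (F : realType) (n m : nat).
Implicit Types (A C P Q S QG : 'M[F]_n) (B D : 'M[F]_(n, m)).
Implicit Types (R L : 'M[F]_m) (K Kb : 'M[F]_(m, n)).

Definition Lam D R P : 'M[F]_m := R + D^T *m P *m D.

Definition cross B C D P : 'M[F]_(m, n) := B^T *m P + D^T *m P *m C.

Definition riccati A B C D L P Q : 'M[F]_n :=
  A^T *m P + P *m A + C^T *m P *m C
  - (cross B C D P)^T *m invmx L *m cross B C D P + Q.

Definition riccati_G A B K L S QG : 'M[F]_n :=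
  (A - B *m K)^T *m S + S *m (A - B *m K)
  - S *m B *m invmx L *m B^T *m S - QG.

Definition loop1 A B C D R Ke (P_ Q_ : nat -> 'M[F]_n)
    (K_ : nat -> 'M[F]_(m, n)) : Prop :=
  Q_ 0%N \is symmetricmx /\
  forall l : nat,
    [/\ (A - B *m Ke)^T *m P_ l + P_ l *m (A - B *m Ke)
          + (C - D *m Ke)^T *m P_ l *m (C - D *m Ke)
        = - Q_ l - Ke^T *m R *m Ke,
        Lam D R (P_ l) \in unitmx,
        K_ l = invmx (Lam D R (P_ l)) *m cross B C D (P_ l)
      & Q_ l.+1 = - (A^T *m P_ l) - P_ l *m A - C^T *m P_ l *m C
                  + (K_ l)^T *m Lam D R (P_ l) *m K_ l].

Definition loop2 A B (Ks : 'M[F]_(m, n)) L Kbe (S_ QG_ : nat -> 'M[F]_n)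
    (Kb_ : nat -> 'M[F]_(m, n)) : Prop :=
  QG_ 0%N \is symmetricmx /\
  forall k : nat,
    [/\ (A - B *m (Ks + Kbe))^T *m S_ k + S_ k *m (A - B *m (Ks + Kbe))
        = - (Kbe^T *m L *m Kbe) + QG_ k,
        Kb_ k = invmx L *m B^T *m S_ k
      & QG_ k.+1 = (A - B *m Ks)^T *m S_ k + S_ k *m (A - B *m Ks)
                   - (Kb_ k)^T *m L *m Kb_ k].

(* Convergence is in the product topology of the matrix space. *)
Definition loop1_converges A B C D R Ke (Ps Qs : 'M[F]_n)
    (Ks : 'M[F]_(m, n)) : Prop :=
  exists (P_ Q_ : nat -> 'M[F]_n) (K_ : nat -> 'M[F]_(m, n)),
    loop1 A B C D R Ke P_ Q_ K_ /\
    [/\ P_ @ \oo --> Ps, Q_ @ \oo --> Qs & K_ @ \oo --> Ks].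

Definition loop2_converges A B (Ks : 'M[F]_(m, n)) L Kbe (Ss QGs : 'M[F]_n)
    (Kbs : 'M[F]_(m, n)) : Prop :=
  exists (S_ QG_ : nat -> 'M[F]_n) (Kb_ : nat -> 'M[F]_(m, n)),
    loop2 A B Ks L Kbe S_ QG_ Kb_ /\
    [/\ S_ @ \oo --> Ss, QG_ @ \oo --> QGs & Kb_ @ \oo --> Kbs].

End Algorithm.

(* Main.v *)
Require Import Defs.
From HB Require Import structures.
From mathcomp Require Import all_boot all_order all_algebra.
From mathcomp Require Import all_classical all_reals all_analysis.
From mathcomp Require Import ring.

Set Implicit Arguments.
Unset Strict Implicit.
Unset Printing Implicit Defensive.

Import Order.TTheory GRing.Theory Num.Theory.
Import numFieldNormedType.Exports.

Local Open Scope classical_set_scope.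
Local Open Scope ring_scope.

(** Two facts make the converged values reproduce the expert's behaviour.

    Both gain formulas survive the passage to the limit.  Along the first loop
    [Lam D R (P_ l) *m K_ l = cross B C D (P_ l)]; both sides are continuous in
    the iterates, so the limits satisfy the same equation, and it can be solved
    for [Ks] because [Ls] is invertible ([loop1_limit_gain]).  In the
    second loop the weight is fixed and the gain is linear in [S_ k]
    ([loop2_limit_gain]).

    The offset equations then say that the expert gains do not move.  Write
    [W = Ro + D^T *m Po *m D].  Since [R = Re + Ro] and [Ps = Pe + Po], the new
    weight is [Ls = Le + W].  The expert gain solves [cross Pe = Le *m Ke], the
    offset satisfies [cross Po = W *m Ke], and adding the two gives
    [cross Ps = Ls *m Ke], whose only solution is [Ks = Ke].  In the same way
    [B^T *m Ss = Ls *m Kbe].  Substituting these factorizations into the Riccati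
    expressions removes the inverse matrix ([riccati_gain], [riccati_G_gain])
    and leaves expressions additive in the weights, so that the equations for
    the starred data are the sums of the expert and the offset equations.

    [Pe] and [Se] may fail to be symmetric, so [Ls^T] has to be kept apart from
    [Ls], and [Ss *m B] from [(B^T *m Ss)^T].  The offset parts do agree with
    their transposed forms, by symmetry of [W] and [So], and this is what makes
    the two sums match. *)

(** A matrix space has finitely many coordinates, so finitely many
    neighbourhood conditions, one per coordinate, can be met at once. *)
Lemma cvg_mx_coord (K : numFieldType) m n (T : Type) (G : set_system T)
    {FG : Filter G} (u : T -> 'M[K]_(m, n)) (M : 'M[K]_(m, n)) :
  (forall i j, u t i j @[t --> G] --> M i j) -> u @ G --> M.
Proof.
move=> uM A [P MP PA].
apply: (@filterS _ _ _ [set t | forall i j, P i j (u t i j)]) => [t /PA//|].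
apply: filter_forall => i; apply: filter_forall => j.
exact: uM (MP i j).
Qed.

Lemma cvg_mulmx (K : numFieldType) m n p (T : Type) (G : set_system T)
    {FG : Filter G} (u : T -> 'M[K]_(m, n)) (v : T -> 'M[K]_(n, p))
    (M : 'M[K]_(m, n)) (N : 'M[K]_(n, p)) :
  u @ G --> M -> v @ G --> N -> (u t *m v t) @[t --> G] --> M *m N.
Proof.
move=> uM vN; apply: cvg_mx_coord => i k.
rewrite mxE; under eq_cvg do rewrite mxE.
apply: cvg_big; first exact: add_continuous.
move=> j _; apply: cvgM.
  exact: (cvg_comp _ _ uM (@coord_continuous K _ _ i j M)).
exact: (cvg_comp _ _ vN (@coord_continuous K _ _ j k N)).
Qed.

Section LimitGains.
Variables (F : realType) (n m : nat).
Implicit Types (A C P Q S QG : 'M[F]_n) (B D : 'M[F]_(n, m)).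
Implicit Types (R L : 'M[F]_m) (K Kb : 'M[F]_(m, n)).

(** The gain equation is used in the form [Lam *m K = cross], where every
    operation is continuous; taking limits in [K = invmx Lam *m cross] would
    require continuity of the inverse. *)
Lemma loop1_limit_gain A B C D R Ke Ps Qs Ks :
  loop1_converges A B C D R Ke Ps Qs Ks -> Lam D R Ps \in unitmx ->
  Ks = invmx (Lam D R Ps) *m cross B C D Ps.
Proof.
move=> [P_ [Q_ [K_ [[_ step] [cvP _ cvK]]]]] Ls_unit.
have cvLam : Lam D R (P_ l) @[l --> \oo] --> Lam D R Ps.
  apply: cvgD; first exact: cvg_cst.
  apply: cvg_mulmx; last exact: cvg_cst.
  by apply: cvg_mulmx => //; exact: cvg_cst.
have cvcross : cross B C D (P_ l) @[l --> \oo] --> cross B C D Ps.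
  apply: cvgD; first by apply: cvg_mulmx => //; exact: cvg_cst.
  apply: cvg_mulmx; last exact: cvg_cst.
  by apply: cvg_mulmx => //; exact: cvg_cst.
have LamK l : Lam D R (P_ l) *m K_ l = cross B C D (P_ l).
  by have [_ Lu -> _] := step l; rewrite mulKVmx.
have: Lam D R (P_ l) *m K_ l @[l --> \oo] --> Lam D R Ps *m Ks.
  exact: cvg_mulmx.
under eq_cvg do rewrite LamK.
by move=> /norm_cvg_unique/(_ cvcross) <-; rewrite mulKmx.
Qed.

Lemma loop2_limit_gain A B K L Kbe Ss QGs Kbs :
  loop2_converges A B K L Kbe Ss QGs Kbs -> Kbs = invmx L *m B^T *m Ss.
Proof.
move=> [S_ [QG_ [Kb_ [[_ step] [cvS _ cvKb]]]]].
have KbE k : Kb_ k = invmx L *m B^T *m S_ k by have [] := step k.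
have: invmx L *m B^T *m S_ k @[k --> \oo] --> invmx L *m B^T *m Ss.
  by apply: cvg_mulmx => //; exact: cvg_cst.
under eq_cvg do rewrite -KbE.
by move=> /norm_cvg_unique/(_ cvKb) ->.
Qed.

(** With [cross = L *m K] the inverse cancels one factor [L]; the other one
    comes transposed, and [L] may fail to be symmetric. *)
Lemma riccati_gain A B C D L P Q K :
  L \in unitmx -> cross B C D P = L *m K ->
  riccati A B C D L P Q =
    A^T *m P + P *m A + C^T *m P *m C - K^T *m L^T *m K + Q.
Proof.
by move=> Lu crossE; rewrite /riccati crossE trmx_mul -[_ *m (L *m K)]mulmxA mulKmx.
Qed.

Lemma riccati_G_gain A B K L S QG Kb :
  L \in unitmx -> B^T *m S = L *m Kb ->
  riccati_G A B K L S QG =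
    (A - B *m K)^T *m S + S *m (A - B *m K) - S *m B *m Kb - QG.
Proof.
by move=> Lu BS; rewrite /riccati_G -(mulmxA _ B^T) BS -(mulmxA (S *m B)) mulKmx.
Qed.

End LimitGains.

Lemma trmx_symmetricmx (F : fieldType) n (M : 'M[F]_n) :
  M \is symmetricmx -> M^T = M.
Proof. by rewrite is_hermitianmxE expr0 scale1r map_mx_id // => /eqP {2}->. Qed.

Theorem theorem19 (F : realType) (n m : nat)
  (A C : 'M[F]_n) (B D : 'M[F]_(n, m))
  (R : 'M[F]_m) (R_sym : R \is symmetricmx)
  (Re Le : 'M[F]_m) (Qe QGe Pe Se : 'M[F]_n) (Ke Kbe : 'M[F]_(m, n))
  (Re_sym : Re \is symmetricmx)
  (Qe_sym : Qe \is symmetricmx) (QGe_sym : QGe \is symmetricmx)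
  (Le_def : Le = Re + D^T *m Pe *m D) (Le_unit : Le \in unitmx)
  (Ke_def : Ke = invmx Le *m (B^T *m Pe + D^T *m Pe *m C))
  (Kbe_def : Kbe = invmx Le *m B^T *m Se)
  (expert_P : riccati A B C D Le Pe Qe = 0)
  (expert_S : riccati_G A B Ke Le Se QGe = 0)
  (Ro : 'M[F]_m) (Ro_def : Ro = R - Re)
  (Qo QGo Po So : 'M[F]_n)
  (Qo_sym : Qo \is symmetricmx) (QGo_sym : QGo \is symmetricmx)
  (Po_sym : Po \is symmetricmx) (So_sym : So \is symmetricmx)
  (offset_K : B^T *m Po + D^T *m Po *m C =
     (Ro + D^T *m Po *m D) *m invmx Le *m (B^T *m Pe + D^T *m Pe *m C))
  (offset_Kb : B^T *m So = (Ro + D^T *m Po *m D) *m invmx Le *m B^T *m Se)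
  (offset_P : A^T *m Po + Po *m A + C^T *m Po *m C + Qo
     - Ke^T *m (Ro + D^T *m Po *m D) *m Ke = 0)
  (offset_S : (A - B *m Ke)^T *m So + So *m (A - B *m Ke) - QGo
     - Kbe^T *m (Ro + D^T *m Po *m D) *m Kbe = 0)
  (Ps Qs Ss QGs : 'M[F]_n) (Ks Kbs : 'M[F]_(m, n)) (Ls : 'M[F]_m)
  (Ls_def : Ls = R + D^T *m Ps *m D) (Ls_unit : Ls \in unitmx)
  (conv1 : loop1_converges A B C D R Ke Ps Qs Ks)
  (conv2 : loop2_converges A B Ks Ls Kbe Ss QGs Kbs)
  (Qs_split : Qs = Qe + Qo) (QGs_split : QGs = QGe + QGo)
  (Ps_split : Ps = Pe + Po) (Ss_split : Ss = Se + So) :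
  [/\ riccati A B C D Ls Ps Qs = 0,
      riccati_G A B Ks Ls Ss QGs = 0,
      Ks = invmx Ls *m (B^T *m Ps + D^T *m Ps *m C) /\ Ks = Ke
    & Kbs = invmx Ls *m B^T *m Ss /\ Kbs = Kbe].
Proof.
pose W := Ro + D^T *m Po *m D.
have W_sym : W^T = W.
  rewrite /W Ro_def !linearD linearN /= !trmx_mul trmxK !trmx_symmetricmx //.
  by rewrite mulmxA.
have LsE : Ls = Le + W.
  rewrite Ls_def Le_def Ps_split /W Ro_def mulmxDr mulmxDl.
  by rewrite [RHS]addrACA [Re + _]addrC subrK.
have crossPe : cross B C D Pe = Le *m Ke by rewrite Ke_def mulKVmx.
have crossPo : cross B C D Po = W *m Ke by rewrite Ke_def mulmxA.
have BSe : B^T *m Se = Le *m Kbe by rewrite Kbe_def -mulmxA mulKVmx.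
have BSo : B^T *m So = W *m Kbe by rewrite offset_Kb Kbe_def !mulmxA.
have crossPs : cross B C D Ps = Ls *m Ke.
  rewrite LsE mulmxDl -crossPe -crossPo Ps_split /cross.
  by rewrite !(mulmxDr, mulmxDl) addrACA.
have BSs : B^T *m Ss = Ls *m Kbe.
  by rewrite LsE mulmxDl -BSe -BSo Ss_split mulmxDr.
have KsE : Ks = invmx Ls *m cross B C D Ps.
  by rewrite Ls_def; apply: loop1_limit_gain conv1 _; rewrite /Lam -Ls_def.
have KbsE := loop2_limit_gain conv2.
have KsKe : Ks = Ke by rewrite KsE crossPs mulKmx.
have KbsKbe : Kbs = Kbe by rewrite KbsE -mulmxA BSs mulKmx.
split; [| | by [] | by []].
- rewrite (riccati_gain _ _ Ls_unit crossPs).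
  have := expert_P; rewrite (riccati_gain _ _ Le_unit crossPe) => expert.
  rewrite -[RHS]addr0 -[X in _ = X + _]expert -[X in _ = _ + X]offset_P -/W.
  rewrite LsE Ps_split Qs_split [(Le + W)^T]linearD /= W_sym !(mulmxDr, mulmxDl).
  by apply/matrixP => i j; rewrite !mxE; ring.
- rewrite KsKe (riccati_G_gain _ _ _ Ls_unit BSs).
  have := expert_S; rewrite (riccati_G_gain _ _ _ Le_unit BSe) => expert.
  (* Transposing the offset equation for [So] turns the second-loop quadratic
     term of the offset into [So *m B *m Kbe]. *)
  have SoB : So *m B = Kbe^T *m W.
    by rewrite -[So]trmx_symmetricmx // -[B]trmxK -trmx_mul BSo trmx_mul W_sym.
  rewrite -[RHS]addr0 -[X in _ = X + _]expert -[X in _ = _ + X]offset_S -/W.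
  rewrite Ss_split QGs_split -SoB.
  move: (A - B *m Ke) => Acl; rewrite !(mulmxDr, mulmxDl).
  by apply/matrixP => i j; rewrite !mxE; ring.
Qed.
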